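(* Let $n\ge 1$, let $J\in\mathbb{C}^{n\times n}$ satisfy $J=J^*=J^{-1}$ and have inertia $(n-q,q)$ (that is, $n-q$ eigenvalues equal to $1$ and $q$ eigenvalues equal to $-1$, counted with multiplicity). Let $A\in\mathbb{C}^{n\times n}$ satisfy $A^*J=JA$ and $\sigma(A)\subset\{z\in\mathbb{C}:|z|\le 1\}$. Then, for every integer $k\ge1$, $$\|A^k\|_2\le \nu_J(A)\left(1+\frac1k\right)^k\mathcal{K}(A).$$ Consequently, $$\mathcal{M}(A)\le e\,\nu_J(A)\,\mathcal{K}(A).$$
   Context: $\|\cdot\|_2$ is the spectral norm (operator norm induced by the Euclidean norm) and $\sigma(A)$ is the spectrum of $A$. For $A\in\mathbb{C}^{n\times n}$ with $\sigma(A)$ in the closed unit disk, define the maximal power growth $\mathcal{M}(A):=\sup_{k\ge0}\|A^k\|_2$ and the Kreiss constant $\mathcal{K}(A):=\sup_{|z|>1}(|z|-1)\|(zI-A)^{-1}\|_2$; either may equal $+\infty$, and inequalities are understood in the extended sense. Let $d(A)$ be the degree of the minimal polynomial of $A$. With $q$ the number of negative eigenvalues of $J$, set $\nu_J(A):=\min\{d(A),\,2q+1,\,2(n-q)+1\}$. *)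

(* Defs.v *)
From HB Require Import structures.
From mathcomp Require Import all_boot all_order all_algebra.
From mathcomp Require Import complex.
From mathcomp Require Import all_classical all_reals all_analysis.

Set Implicit Arguments.
Unset Strict Implicit.
Unset Printing Implicit Defensive.

Import Order.TTheory GRing.Theory Num.Theory Normc.
Import numFieldNormedType.Exports.

Local Open Scope classical_set_scope.
Local Open Scope ring_scope.
Local Open Scope sesquilinear_scope.

Section Defs.
Variable R : realType.
Local Notation C := R[i].

Definition norm2 (n : nat) (x : 'cV[C]_n) : R :=
  Num.sqrt (\sum_(i < n) normc (x i ord0) ^+ 2).

Definition spectral_norm (m n : nat) (A : 'M[C]_(m, n)) : R :=
  sup [set norm2 (A *m x) | x in [set x : 'cV[C]_n | norm2 x <= 1]].

(* [sup] is 0 on unbounded sets; this rules that case out. *)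
Lemma spectral_norm_has_sup (m n : nat) (A : 'M[C]_(m, n)) :
  has_sup [set norm2 (A *m x) | x in [set x : 'cV[C]_n | norm2 x <= 1]].
Proof.
have sum_sq_ge0 p (y : 'cV[C]_p) : 0 <= \sum_(i < p) normc (y i ord0) ^+ 2.
  by apply: sumr_ge0 => i _; exact: sqr_ge0.
split.
  exists (norm2 (A *m 0)), 0 => //=.
  rewrite /norm2 big1 ?sqrtr0// => i _.
  by rewrite mxE normc0 expr0n.
exists (Num.sqrt (\sum_(i < m) (\sum_(j < n) normc (A i j)) ^+ 2)).
move=> _ [x /= x1 <-]; rewrite /norm2 ler_sqrt; last first.
  by apply: sumr_ge0 => i _; exact: sqr_ge0.
have normc_ge0 (z : C) : 0 <= normc z by case: z => a b; exact: sqrtr_ge0.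
have xj j : normc (x j ord0) <= 1.
  apply: le_trans x1; rewrite /norm2 -[leLHS]ger0_norm// -sqrtr_sqr.
  rewrite ler_sqrt ?sum_sq_ge0// (bigD1 j)//= lerDl.
  by apply: sumr_ge0 => i _; exact: sqr_ge0.
apply: ler_sum => i _; rewrite lerXn2r ?nnegrE ?sumr_ge0// mxE.
have: normc (\sum_j A i j * x j ord0) <= \sum_j normc (A i j * x j ord0).
  elim/big_ind2 : _ => [|u a v b ua vb|//]; first by rewrite normc0.
  exact: le_trans (le_normcD _ _) (lerD ua vb).
move=> /le_trans; apply; apply: ler_sum => j _.
by rewrite normcM ler_piMr.
Qed.

Definition power_growth (n : nat) (A : 'M[C]_n.+1) : \bar R :=
  ereal_sup [set (spectral_norm (A ^+ k))%:E | k in [set: nat]].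

(* When the spectrum of [A] lies in the closed unit disk, [z%:M - A] is
   invertible for [1 < |z|], so the default value of [invmx] is never used. *)
Definition kreiss (n : nat) (A : 'M[C]_n.+1) : \bar R :=
  ereal_sup [set ((normc z - 1) * spectral_norm (invmx (z%:M - A)))%:E
            | z in [set z : C | 1 < normc z]].

(* Eigenvalues repeated according to their algebraic multiplicity. *)
Definition eigenvalues (n : nat) (A : 'M[C]_n) : seq C :=
  sval (closed_field_poly_normal (char_poly A)).

(* In the order of [C], [z < 0] means that [z] is a negative real number. *)
Definition neg_index (n : nat) (J : 'M[C]_n) : nat :=
  count (fun z => z < 0) (eigenvalues J).

Definition inertia (n : nat) (J : 'M[C]_n) : nat * nat :=
  (count (fun z => 0 < z) (eigenvalues J), neg_index J).

Definition nu (n : nat) (J A : 'M[C]_n.+1) : nat :=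
  let q := neg_index J in
  minn (degree_mxminpoly A) (minn (2 * q + 1) (2 * (n.+1 - q) + 1)).

End Defs.

(* Main.v *)
(* Fix a vector [x], put [rho = 1 + 1/k], [N = k + 1], and consider the Hankel
   matrix [H] with entries [rho^-(i+j) x^* J A^(i+j) x]. Its symbol on the unit
   circle is the function [(rho/w) x^* J (rho/w - A)^-1 x], so [H] has operator
   norm at most [M = rho K(A) |x|^2 / (rho - 1)]; and [tr H], half the sum of
   the values of the symbol at 1 and -1, is at most [M] in absolute value,
   without any factor for the size. If [Z] is the permutation matrix that
   reverses the first [N] indices and, separately, the remaining ones, then
   [tr (Z H)] is [N rho^-k x^* J A^k x] up to a negligible tail.
   - [H] has rank at most [d(A)], so [|tr (Z H)| <= d(A) M].
   - [H = W^* J W] has at most [q] negative squares and [0 <= 1 - Z <= 2], so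
     [tr H - tr (Z H) = tr ((1 - Z) H) >= - 2 q M], that is
     [tr (Z H) <= (2 q + 1) M]; the same holds with [- Z] for [Z], and
     [2 (n - q) + 1] is obtained from [- J].
   Finally [J A^k] is Hermitian, so that a bound on its quadratic form is a
   bound on its norm, which is the norm of [A^k]. *)
Require Import Defs.
From HB Require Import structures.
From mathcomp Require Import all_boot all_order all_algebra.
From mathcomp Require Import all_fingroup all_solvable all_field complex.
From mathcomp Require Import all_classical all_reals all_analysis.
From mathcomp Require Import ring lra zify.

Set Implicit Arguments.
Unset Strict Implicit.
Unset Printing Implicit Defensive.

Import Order.TTheory GRing.Theory Num.Theory.
Import numFieldNormedType.Exports.

Local Open Scope classical_set_scope.
Local Open Scope ring_scope.
Local Open Scope sesquilinear_scope.

(** * Hermitian forms and Hankel matrices *)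

Section Hermitian.
Variable C : numClosedFieldType.

Definition sqn n (u : 'cV[C]_n) : C := \sum_i `|u i 0| ^+ 2.

Definition sform m n (x : 'cV[C]_m) (G : 'M[C]_(m, n)) (y : 'cV[C]_n) : C :=
  (x ^t* *m G *m y) 0 0.

Lemma sqn_ge0 n (u : 'cV[C]_n) : 0 <= sqn u.
Proof. by apply: sumr_ge0 => i _; rewrite exprn_ge0. Qed.

Lemma trmxC_mul m n p (A : 'M[C]_(m, n)) (B : 'M[C]_(n, p)) :
  (A *m B) ^t* = B ^t* *m A ^t*.
Proof. by rewrite trmx_mul map_mxM. Qed.

Lemma sqnE n (u : 'cV[C]_n) : sqn u = (u ^t* *m u) 0 0.
Proof. by rewrite mxE; apply: eq_bigr => i _; rewrite !mxE normCKC. Qed.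

Lemma sformE m n (x : 'cV[C]_m) (G : 'M[C]_(m, n)) (y : 'cV[C]_n) :
  sform x G y = \sum_i \sum_j (x i 0)^* * G i j * y j 0.
Proof.
rewrite /sform mxE exchange_big; apply: eq_bigr => j _ /=.
by rewrite mxE mulr_suml; apply: eq_bigr => i _; rewrite !mxE.
Qed.

Lemma sqn_col (m n : nat) (A : 'M[C]_(m, n)) j :
  sqn (col j A) = (A ^t* *m A) j j.
Proof. by rewrite mxE; apply: eq_bigr => i _; rewrite !mxE normCKC. Qed.

Lemma sform_col m n p q (A : 'M[C]_(m, p)) (G : 'M[C]_(m, n))
    (B : 'M[C]_(n, q)) i j :
  sform (col i A) G (col j B) = (A ^t* *m G *m B) i j.
Proof.
rewrite /sform !mxE; apply: eq_bigr => k _; rewrite !mxE; congr (_ * _).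
by apply: eq_bigr => l _; rewrite !mxE.
Qed.

Lemma sform_conj m n (x : 'cV[C]_m) (G : 'M[C]_(m, n)) (y : 'cV[C]_n) :
  (sform x G y)^* = sform y (G ^t*) x.
Proof.
have -> : (sform x G y)^* = ((x ^t* *m G *m y) ^t*) 0 0.
  by rewrite [RHS]mxE [in RHS]mxE.
by rewrite !trmxC_mul trmxCK mulmxA.
Qed.

Lemma sform_real n (x : 'cV[C]_n) (G : 'M[C]_n) :
  G ^t* = G -> sform x G x \is Num.real.
Proof. by move=> Gh; apply/CrealP; rewrite sform_conj Gh. Qed.

Lemma sqn_sub_le n (u v : 'cV[C]_n) : sqn (u - v) <= 2 * (sqn u + sqn v).
Proof.
rewrite /sqn -big_split /= mulr_sumr; apply: ler_sum => i _; rewrite !mxE.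
have /le_trans-> // : `|u i 0 - v i 0| ^+ 2 <= (`|u i 0| + `|v i 0|) ^+ 2.
  by rewrite lerXn2r ?nnegrE ?addr_ge0 // ler_normB.
rewrite -subr_ge0.
have -> : 2 * (`|u i 0| ^+ 2 + `|v i 0| ^+ 2) - (`|u i 0| + `|v i 0|) ^+ 2
  = (`|u i 0| - `|v i 0|) ^+ 2 by rewrite sqrrD sqrrB; ring.
by rewrite -realEsqr realB ?normr_real.
Qed.

(** In a rank factorization [P = E *m F], idempotence forces [F *m E = 1%:M], and [P] has the trace
    of [F *m E]. *)
Lemma mxtrace_idem n (P : 'M[C]_n) : P *m P = P -> \tr P = (\rank P)%:R.
Proof.
move=> PP; have /row_fullP [B] := col_base_full P;
  have /row_freeP [D] := row_base_free P.
have := mulmx_base P; move: (\rank P) (col_base P) (row_base P) B D.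
move=> r E F B D EF FD BE.
have FE : F = B *m P by rewrite -EF mulmxA BE mul1mx.
have ED : E = P *m D by rewrite -EF -mulmxA FD mulmx1.
rewrite -[in LHS]EF mxtrace_mulC {1}FE {1}ED mulmxA -(mulmxA B) PP -FE FD.
exact: mxtrace1.
Qed.

(** The projection onto the row space of [K]: by [K *m P = K] the columns of [1%:M - P] lie in the
    kernel of [K], and the trace is the sum of the squared lengths of the columns of [P]. *)
Lemma ortho_projection d n (K : 'M[C]_(d, n)) :
  exists P : 'M[C]_n,
    [/\ P ^t* = P, P *m P = P, K *m P = K & \tr P <= d%:R].
Proof.
pose P := proj_ortho K; have PP : P *m P = P by exact: proj_ortho_proj.
(* The rows of [P] lie in the row space of [K], those of [1%:M - P] in its orthogonal complement; so
   [P = P *m P ^t*] is Hermitian. *)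
have P0 : P *m (1%:M - P) ^t* = 0.
  apply/orthomx1P; rewrite orthomx_sym.
  have := proj_ortho_compl_sub K (1%:M : 'M[C]_n);
    rewrite mul1mx => /submx_trans.
  by apply; rewrite submx_ortho proj_orthoE.
have PE : P *m P ^t* = P.
  move: P0; rewrite raddfB /= trmx1 map_mxB map_mx1 mulmxBr mulmx1.
  by move/subr0_eq.
have Ph : P ^t* = P by rewrite -[in LHS]PE trmxC_mul trmxCK PE.
exists P; split => //; first by rewrite proj_ortho_id.
by rewrite mxtrace_idem // ler_nat proj_orthoE rank_leq_row.
Qed.

End Hermitian.

(** * Discrete Fourier sums and the norm of a Hankel form *)

Section Hankel.
Variable C : numClosedFieldType.

Lemma exists_prim_root n : (0 < n)%N -> exists w : C, n.-primitive_root w.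
Proof.
pose p : {poly C} := 'X^n - 1; have [r Dp] := closed_field_poly_normal p.
move=> n_gt0; rewrite (monicP _) ?monicXnsubC // scale1r in Dp.
have rn1 : all n.-unity_root r by apply/allP=> z; rewrite -root_prod_XsubC -Dp.
have sz_r : (n < (size r).+1)%N.
  by rewrite -(size_prod_XsubC r id) -Dp size_XnsubC.
have [|z _ zP] := hasP (has_prim_root n_gt0 rn1 _ sz_r); last by exists z.
by rewrite -separable_prod_XsubC -Dp separable_Xn_sub_1 // pnatr_eq0 -lt0n.
Qed.

Lemma norm_unity_root n (w : C) : (0 < n)%N -> w ^+ n = 1 -> `|w| = 1.
Proof.
move=> n_gt0 wn; apply/eqP; rewrite -(@pexpr_eq1 _ _ n) //.
by rewrite -normrX wn normr1.
Qed.

(** A geometric sum whose ratio has T-th power 1; a, b < T keep the ratio away from 1 when a and b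
    differ. *)
Lemma prim_root_orthogonal T (w : C) a b : T.-primitive_root w ->
  (a < T)%N -> (b < T)%N ->
  \sum_(s < T) w ^+ (s * a) / w ^+ (s * b) = T%:R * (a == b)%:R.
Proof.
move=> wP aT bT; have T0 := prim_order_gt0 wP.
have w1 := norm_unity_root T0 (prim_expr_order wP).
have w0 : w != 0 by rewrite -normr_eq0 w1 oner_eq0.
rewrite (eq_bigr (fun s : 'I_T => (w ^+ a / w ^+ b) ^+ s)); last first.
  by move=> s _; rewrite exprMn exprVn -!exprM ![(_ * s)%N]mulnC.
have [->|nab] := eqVneq.
  rewrite divff ?expf_neq0 // (eq_bigr (fun=> 1)); last first.
    by move=> *; rewrite expr1n.
  by rewrite sumr_const card_ord mulr1.
have z1 : w ^+ a / w ^+ b != 1.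
  apply: contra nab => /eqP/divr1_eq/eqP.
  by rewrite (eq_prim_root_expr wP) !modn_small.
apply: (mulfI (_ : w ^+ a / w ^+ b - 1 != 0)); first by rewrite subr_eq0.
rewrite -subrX1 exprMn exprVn -!exprM ![(_ * T)%N]mulnC !exprM.
by rewrite (prim_expr_order wP) !expr1n invr1 mulr1 subrr !mulr0.
Qed.

(** Orthogonality of characters, for [v] padded with zeros to length T. *)
Lemma parseval T L (w : C) (v : 'cV[C]_L) : T.-primitive_root w -> (L <= T)%N ->
  \sum_(s < T) `|\sum_(j < L) v j 0 * w ^+ (s * j)| ^+ 2 = T%:R * sqn v.
Proof.
move=> wP LT; have T0 := prim_order_gt0 wP.
have w1 := norm_unity_root T0 (prim_expr_order wP).
have wC k : (w ^+ k)^* = (w ^+ k)^-1.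
  by rewrite invC_norm normrX w1 !expr1n invr1 mul1r.
under eq_bigr => s _ do rewrite normCK rmorph_sum /= big_distrlr /=.
rewrite exchange_big mulr_sumr; apply: eq_bigr => i _.
rewrite exchange_big (bigD1 i) //= [X in _ + X]big1 ?addr0; last first.
  move=> j ji.
  rewrite (eq_bigr (fun s : 'I_T => v i 0 * (v j 0)^* *
    (w ^+ (s * i) / w ^+ (s * j)))); last first.
    by move=> s _; rewrite rmorphM /= wC mulrACA.
  rewrite -mulr_sumr (prim_root_orthogonal wP) ?(leq_trans (ltn_ord _)) //.
  by rewrite eq_sym val_eqE (negbTE ji) !mulr0.
rewrite (eq_bigr (fun s : 'I_T => v i 0 * (v i 0)^* *
    (w ^+ (s * i) / w ^+ (s * i)))); last first.
  by move=> s _; rewrite rmorphM /= wC mulrACA.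
rewrite -mulr_sumr (prim_root_orthogonal wP) ?(leq_trans (ltn_ord _)) //.
by rewrite eqxx mulr1 normCK mulrC.
Qed.

(* The form is the integral over the unit circle (here the mean over the [T]-th
   roots of unity) of the symbol [sum_j c_j z^j] against a product of two
   polynomials of degree less than [L]. *)
Lemma hankel_form_bound T L (c : nat -> C) (M : C) (u v : 'cV[C]_L) :
  (2 * L <= T)%N -> (0 < T)%N ->
  (forall w, w ^+ T = 1 -> `|\sum_(j < T) c j * w ^+ j| <= M) ->
  `|sform u (\matrix_(i, j) c (i + j)%N) v| <= M / 2 * (sqn u + sqn v).
Proof.
move=> LT T0 cM; have [w wP] := exists_prim_root T0.
have LT' : (L <= T)%N by rewrite (leq_trans _ LT) // mul2n -addnn leq_addr.
have w1 := norm_unity_root T0 (prim_expr_order wP).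
pose g (s : 'I_T) := \sum_(j < T) c j * (w ^- s) ^+ j.
pose U (s : 'I_T) := \sum_(i < L) (u i 0)^* * w ^+ (s * i).
pose V (s : 'I_T) := \sum_(i < L) v i 0 * w ^+ (s * i).
have TM : T%:R * sform u (\matrix_(i, j) c (i + j)%N) v =
    \sum_s g s * (U s * V s).
  have -> : \sum_s g s * (U s * V s) =
      \sum_(s < T) \sum_(i < L) \sum_(j < L) \sum_(m < T)
        (u i 0)^* * c m * v j 0 * (w ^+ (s * (i + j)) / w ^+ (s * m)).
    apply: eq_bigr => s _; rewrite /U /V big_distrlr mulr_sumr.
    apply: eq_bigr => i _; rewrite mulr_sumr; apply: eq_bigr => j _.
    rewrite mulr_suml; apply: eq_bigr => m _ /=.
    by rewrite mulnDr exprD exprVn -exprM; ring.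
  rewrite exchange_big sformE mulr_sumr; apply: eq_bigr => i _ /=.
  rewrite exchange_big mulr_sumr; apply: eq_bigr => j _ /=.
  (* No aliasing: i + j stays below T, so exactly one coefficient survives the mean over s. *)
  have ijT : (i + j < T)%N.
    by rewrite (leq_trans _ LT) // mul2n -addnn -addSn leq_add // ltnW.
  rewrite exchange_big (bigD1 (Ordinal ijT)) //= [X in _ + X]big1 ?addr0.
    rewrite -mulr_sumr (prim_root_orthogonal wP) // eqxx mulr1 mxE.
    by rewrite mulrC.
  move=> m mij; rewrite -mulr_sumr (prim_root_orthogonal wP) //.
  by move: mij; rewrite -val_eqE /= eq_sym => /negbTE ->; rewrite !mulr0.
have TR : 0 < T%:R :> C by rewrite ltr0n.
rewrite -(ler_pM2l TR) -[X in X * `|_|]gtr0_norm // -normrM TM.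
apply: le_trans (ler_norm_sum _ _ _) _.
have sC : sqn (\col_i (u i 0)^*) = sqn u.
  by apply: eq_bigr => i _; rewrite mxE norm_conjC.
rewrite mulrCA mulrDr -{1}sC -!(parseval _ wP LT') -big_split mulr_sumr /=.
apply: ler_sum => s _; rewrite normrM.
have gM : `|g s| <= M.
  by apply: cM; rewrite exprVn -exprM mulnC exprM (prim_expr_order wP) expr1n
    invr1.
have M0 : 0 <= M := le_trans (normr_ge0 _) gM.
apply: le_trans (ler_wpM2r (normr_ge0 _) gM) _; rewrite -mulrA ler_wpM2l //.
under [X in `|X| ^+ 2 + _]eq_bigr => i _ do rewrite mxE.
rewrite -/(U s) -/(V s) normrM ler_pdivlMl // -subr_ge0.
have -> : `|U s| ^+ 2 + `|V s| ^+ 2 - 2 * (`|U s| * `|V s|) =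
    (`|U s| - `|V s|) ^+ 2.
  by ring.
by rewrite -realEsqr realB ?normr_real.
Qed.

End Hankel.

(** * Trace inequalities from rank and from negative squares *)

Section Trace.
Variable C : numClosedFieldType.

Lemma mxtrace_sform n (P G : 'M[C]_n) : P ^t* = P -> P *m P = P ->
  \tr (G *m P) = \sum_i sform (col i P) G (col i P).
Proof.
move=> Ph PP; rewrite -{1}PP mulmxA mxtrace_mulC mulmxA.
by apply: eq_bigr => i _; rewrite sform_col Ph.
Qed.

Lemma sum_sqn_col n (P : 'M[C]_n) : P ^t* = P -> P *m P = P ->
  \sum_i sqn (col i P) = \tr P.
Proof. by move=> Ph PP; apply: eq_bigr => i _; rewrite sqn_col Ph PP. Qed.

(** With the projection [P] on the row space of [K2] inserted, the trace is a sum of forms at the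
    columns of [Z ^t* *m P] and [P]. They have equal lengths, whose squares add up to [\tr P <= d],
    whatever n is. *)
Lemma norm_mxtrace_rank_le d n (M : C) (K1 : 'M[C]_(n, d)) (K2 : 'M[C]_(d, n))
    (Z : 'M[C]_n) : 0 <= M -> Z *m Z ^t* = 1%:M ->
  (forall u v, `|sform u (K1 *m K2) v| <= M / 2 * (sqn u + sqn v)) ->
  `|\tr (Z *m (K1 *m K2))| <= d%:R * M.
Proof.
move=> M0 ZZ HM; have [P [Ph PP KP trP]] := ortho_projection K2.
have -> : \tr (Z *m (K1 *m K2)) =
    \sum_i sform (col i (Z ^t* *m P)) (K1 *m K2) (col i P).
  have -> : Z *m (K1 *m K2) = Z *m (K1 *m K2) *m P *m P.
    by rewrite -mulmxA PP -!mulmxA KP.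
  rewrite mxtrace_mulC; apply: eq_bigr => i _.
  by rewrite sform_col trmxC_mul trmxCK Ph !mulmxA.
apply: le_trans (ler_norm_sum _ _ _) _.
apply: (@le_trans _ _ (\sum_i M * sqn (col i P))).
  apply: ler_sum => i _; apply: le_trans (HM _ _) _.
  rewrite !sqn_col trmxC_mul trmxCK Ph mulmxA -(mulmxA P) ZZ mulmx1 PP.
  by rewrite le_eqVlt; apply/orP; left; apply/eqP; field.
by rewrite -mulr_sumr sum_sqn_col // mulrC ler_wpM2r.
Qed.

(** The trace splits along [P], the projection on the row space of [K], and [Q], that on its kernel:
    the second part is nonnegative, the first loses at most [a] per dimension. *)
Lemma mxtrace_neg_ge r n (a : C) (G : 'M[C]_n) (K : 'M[C]_(r, n)) : 0 <= a ->
  (forall v, K *m v = 0 -> 0 <= sform v G v) ->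
  (forall v, - (a * sqn v) <= sform v G v) ->
  - (a * r%:R) <= \tr G.
Proof.
move=> a0 Kpos Gge; have [P [Ph PP KP trP]] := ortho_projection K.
pose Q : 'M[C]_n := 1%:M - P.
have Qh : Q ^t* = Q by rewrite /Q raddfB /= trmx1 map_mxB map_mx1 Ph.
have QQ : Q *m Q = Q.
  by rewrite /Q mulmxBr mulmx1 mulmxBl mul1mx PP subrr subr0.
have -> : \tr G = \tr (G *m P) + \tr (G *m Q).
  by rewrite -raddfD -mulmxDr /Q addrC subrK mulmx1.
rewrite -[leLHS]addr0 lerD //; last first.
  rewrite mxtrace_sform // sumr_ge0 // => i _; apply: Kpos.
  by rewrite colE mulmxA mulmxBr mulmx1 KP subrr mul0mx.
rewrite mxtrace_sform //; apply: (@le_trans _ _ (\sum_i - (a * sqn (col i P)))).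
  by rewrite sumrN lerN2 -mulr_sumr sum_sqn_col // ler_wpM2l.
by apply: ler_sum => i _.
Qed.

(** [S = 1%:M - Z] has S^2 = 2 S, so [S *m H *m S] has twice the trace of [S *m H]. Its form is at
    least -4 M |v|^2 as |S v| <= 2 |v|, and it is nonnegative on the kernel of [F *m W *m S], where
    J fixes W S v. *)
Lemma mxtrace_isometry_le r n L (M : C) (J : 'M[C]_n) (F : 'M[C]_(r, n))
    (W : 'M[C]_(n, L)) (Z : 'M[C]_L) : 0 <= M ->
  (forall y : 'cV_n, F *m y = 0 -> J *m y = y) ->
  Z ^t* = Z -> Z *m Z = 1%:M ->
  let H := W ^t* *m J *m W in
  (forall v, `|sform v H v| <= M * sqn v) -> H ^t* = H ->
  \tr (Z *m H) <= \tr H + 2 * M * r%:R.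
Proof.
move=> M0 FJ Zh ZZ H HM Hh; pose S : 'M[C]_L := 1%:M - Z.
pose G := S ^t* *m H *m S.
have sG v : sform v G v = sform (S *m v) H (S *m v).
  by rewrite /sform /G trmxC_mul !mulmxA.
have Sh : S ^t* = S by rewrite /S raddfB /= trmx1 map_mxB map_mx1 Zh.
have trG : \tr G = 2 * (\tr H - \tr (Z *m H)).
  rewrite /G Sh /S !(mulmxBl, mulmxBr, mul1mx, mulmx1) !raddfB /=.
  have -> : \tr (Z *m H *m Z) = \tr H by rewrite mxtrace_mulC mulmxA ZZ mul1mx.
  by rewrite (mxtrace_mulC H); ring.
have : - (4 * M * r%:R) <= \tr G.
  apply: (@mxtrace_neg_ge r L (4 * M) G (F *m W *m S)).
  - by rewrite mulr_ge0.
  - move=> v; rewrite -!mulmxA => /FJ JWS.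
    rewrite sG /sform /H -!mulmxA JWS.
    apply: le_trans (sqn_ge0 (W *m (S *m v))) _.
    by rewrite sqnE [(W *m _) ^t*]trmxC_mul !mulmxA.
  - move=> v; rewrite sG.
    have Hreal : sform (S *m v) H (S *m v) \is Num.real by exact: sform_real.
    have := HM (S *m v); rewrite real_ler_norml // => /andP [+ _].
    apply: le_trans; rewrite lerN2 (mulrC 4) -mulrA ler_wpM2l //.
    rewrite /S mulmxBl mul1mx; apply: le_trans (sqn_sub_le _ _) _.
    have -> : sqn (Z *m v) = sqn v.
      by rewrite !sqnE trmxC_mul Zh mulmxA -(mulmxA _ Z Z) ZZ mulmx1.
    by rewrite le_eqVlt; apply/orP; left; apply/eqP; ring.
rewrite trG => h.
have : 0 <= 2 * (\tr H - \tr (Z *m H)) + 4 * M * r%:R.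
  by rewrite -subr_ge0 opprK in h.
have -> : 2 * (\tr H - \tr (Z *m H)) + 4 * M * r%:R =
  2 * (\tr H + 2 * M * r%:R - \tr (Z *m H)) by ring.
by rewrite pmulr_rge0 // subr_ge0.
Qed.

End Trace.

(** * The permutation that reverses two blocks of indices *)

Section Flip.
Variables (N L : nat) (NL : (0 < N <= L)%N).

(** The sum of i and its image is N - 1 on the first block and N + L - 1 on the second: two
    antidiagonals of a Hankel matrix. *)
Definition flip_nat i := if (i < N)%N then (N.-1 - i)%N else (N + L.-1 - i)%N.

Lemma flip_nat_lt i : (i < L)%N -> (flip_nat i < L)%N.
Proof.
by case/andP: NL => N0 NL' iL; rewrite /flip_nat; case: ifP => iN; lia.
Qed.

Definition flip_ord (i : 'I_L) : 'I_L := Ordinal (flip_nat_lt (ltn_ord i)).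

Lemma flip_ordK : involutive flip_ord.
Proof.
case/andP: NL => N0 NL' i; apply/val_inj; rewrite /= /flip_nat.
by have := ltn_ord i; case: (ltnP i N) => iN iL; case: ifP => h; lia.
Qed.

Definition flip_perm := perm (inv_inj flip_ordK).

Lemma flip_permV : flip_perm^-1%g = flip_perm.
Proof.
apply/permP => i; apply: (perm_inj (s := flip_perm)).
by rewrite permKV !permE flip_ordK.
Qed.

Variable C : numClosedFieldType.

Lemma flip_mxC : (perm_mx flip_perm : 'M[C]_L) ^t* = perm_mx flip_perm.
Proof. by rewrite tr_perm_mx map_perm_mx flip_permV. Qed.

Lemma flip_mxK : perm_mx flip_perm *m perm_mx flip_perm = 1%:M :> 'M[C]_L.
Proof. by rewrite -perm_mxM -{1}flip_permV mulVg perm_mx1. Qed.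

Lemma mxtrace_flip (c : nat -> C) :
  \tr (perm_mx flip_perm *m \matrix_(i < L, j < L) c (i + j)%N) =
  N%:R * c N.-1 + (L - N)%:R * c (N + L.-1)%N.
Proof.
case/andP: NL => N0 NL'; rewrite /mxtrace.
under eq_bigr => i _ do rewrite -row_permE !mxE permE /= /flip_nat.
pose f i := if (i < N)%N then c N.-1 else c (N + L.-1)%N.
rewrite (eq_bigr (fun i : 'I_L => f i)); last first.
  by move=> i _; have := ltn_ord i; rewrite /f; case: (ltnP i N) => iN iL;
    congr (c _); lia.
rewrite -(big_mkord xpredT f) (big_cat_nat (leq0n N) NL') //=; congr (_ + _).
  rewrite (eq_big_nat _ _ (F2 := fun=> c N.-1)); last first.
    by move=> i /andP[_ iN]; rewrite /f iN.
  by rewrite sumr_const_nat subn0 mulr_natl.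
rewrite (eq_big_nat _ _ (F2 := fun=> c (N + L.-1)%N)); last first.
  by move=> i /andP[iN _]; rewrite /f ltnNge iN.
by rewrite sumr_const_nat mulr_natl.
Qed.

End Flip.

(** * The corner entry of a Hankel matrix, bounded by the symbol *)

Section Corner.
Variable C : numClosedFieldType.

(** With L = N the flip has no second block; T stays free, so that the truncated symbol can be as
    long as desired. *)
Lemma hankel_corner_rank d N T (c : nat -> C) (M : C)
    (K1 : 'M[C]_(N, d)) (K2 : 'M[C]_(d, N)) :
  (0 < N)%N -> (2 * N <= T)%N ->
  (forall w, w ^+ T = 1 -> `|\sum_(j < T) c j * w ^+ j| <= M) ->
  \matrix_(i, j) c (i + j)%N = K1 *m K2 ->
  `|N%:R * c N.-1| <= d%:R * M.
Proof.
move=> N0 NT cM cK; have NL : (0 < N <= N)%N by rewrite N0 /=.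
have T0 : (0 < T)%N by lia.
have M0 : 0 <= M by apply: le_trans (normr_ge0 _) (cM 1 (expr1n _ _)).
have := mxtrace_flip NL c; rewrite subnn mul0r addr0 => <-; rewrite cK.
apply: norm_mxtrace_rank_le => //; first by rewrite flip_mxC flip_mxK.
by move=> u v; rewrite -cK (hankel_form_bound _ _ NT).
Qed.

(** The symbol must have exactly 2 L terms to yield the trace of [H] from its values at 1 and -1. To
    make it long, L may exceed N, and the second block of the flip gives the last term. *)
Lemma hankel_corner_isometry n r N L (c : nat -> C) (M : C) (J : 'M[C]_n)
    (F : 'M[C]_(r, n)) (W : 'M[C]_(n, L)) :
  (0 < N <= L)%N ->
  (forall w, w ^+ (2 * L) = 1 -> `|\sum_(j < 2 * L) c j * w ^+ j| <= M) ->
  J ^t* = J -> (forall y : 'cV_n, F *m y = 0 -> J *m y = y) ->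
  \matrix_(i, j) c (i + j)%N = W ^t* *m J *m W ->
  `|N%:R * c N.-1| <= (2 * r + 1)%:R * M + `|L%:R * c (N + L.-1)%N|.
Proof.
move=> NL cM Jh FJ cH; set H := W ^t* *m J *m W in cH.
have L0 : (0 < L)%N by lia.
have M0 : 0 <= M by apply: le_trans (normr_ge0 _) (cM 1 (expr1n _ _)).
have Hh : H ^t* = H by rewrite /H !trmxC_mul trmxCK Jh mulmxA.
have HM v : `|sform v H v| <= M * sqn v.
  rewrite -cH; have -> : M * sqn v = M / 2 * (sqn v + sqn v) by field.
  by apply: hankel_form_bound (leqnn _) _ cM; lia.
have trH : `|\tr H| <= M.
  (* Averaging over 1 and -1 kills the odd coefficients and leaves c_0 + c_2 + ... + c_(2L-2), the
     diagonal of [H]. *)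
  have -> : \tr H = 2^-1 * (\sum_(j < 2 * L) c j * 1 ^+ j +
                            \sum_(j < 2 * L) c j * (- 1) ^+ j).
    rewrite -cH /mxtrace -big_split /= -(big_mkord xpredT (fun i =>
      c i * 1 ^+ i + c i * (-1) ^+ i)) mul2n -addnn.
    under eq_bigr => i _ do rewrite mxE.
    rewrite -(big_mkord xpredT (fun i => c (i + i)%N)).
    elim: (L) => [|l IHl]; first by rewrite !big_geq // mulr0.
    rewrite addSn addnS !big_nat_recr //= IHl -!addrA !mulrDr; congr (_ + _).
    rewrite !expr1n exprS addnn -signr_odd odd_double expr0 !mulr1 mulrN mulr1.
    by field.
  rewrite normrM normfV normr_nat ler_pdivrMl ?ltr0n // mulr_natl mulr2n.
  apply: le_trans (ler_normD _ _) (lerD _ _); apply: cM; rewrite ?expr1n //.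
  by rewrite mul2n -addnn -signr_odd oddD addbb.
have trC (Z : 'M[C]_L) : Z ^t* = Z -> \tr (Z *m H) \is Num.real.
  move=> Zh; apply/CrealP.
  have -> : (\tr (Z *m H))^* = \tr ((Z *m H) ^t*).
    by rewrite rmorph_sum; apply: eq_bigr => i _; rewrite !mxE.
  by rewrite trmxC_mul Hh Zh mxtrace_mulC.
have Hr : \tr H \is Num.real.
  by rewrite -(mul1mx H) trC // trmx1 map_mx1.
have {}trH : \tr H <= M by apply: le_trans (real_ler_norm Hr) trH.
pose Z : 'M[C]_L := perm_mx (flip_perm NL).
have Zh : Z ^t* = Z := flip_mxC NL C.
have ZZ : Z *m Z = 1%:M := flip_mxK NL C.
have NZh : (- Z) ^t* = - Z by rewrite raddfN /= map_mxN Zh.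
have TF := mxtrace_flip NL c; rewrite -/Z in TF.
have ZH : `|\tr (Z *m H)| <= (2 * r + 1)%:R * M.
  have le : \tr H + 2 * M * r%:R <= (2 * r + 1)%:R * M.
    have -> : (2 * r + 1)%:R * M = M + 2 * M * r%:R by rewrite natrD natrM;
      ring.
    by rewrite lerD2r.
  rewrite real_ler_norml ?trC // lerNl -raddfN -mulNmx; apply/andP; split.
    apply: le_trans le; apply: (mxtrace_isometry_le (F := F)) => //.
    by rewrite mulNmx mulmxN opprK.
  by apply: le_trans le; apply: (mxtrace_isometry_le (F := F)).
rewrite cH in TF; rewrite TF in ZH.
rewrite -[X in `|X| <= _](addrK ((L - N)%:R * c (N + L.-1)%N)).
apply: le_trans (ler_normB _ _) (lerD ZH _).
by rewrite !normrM ler_wpM2r // !normr_nat ler_nat leq_subr.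
Qed.

End Corner.

(** * The Euclidean and spectral norms *)

Section Norm.
Import Normc.
Variable R : realType.
Local Notation C := R[i].
Implicit Types (n m : nat).

Lemma normcE (z : C) : `|z| = (normc z)%:C%C. Proof. by []. Qed.

Lemma normc_le (z : C) (r : R) : (normc z <= r) = (`|z| <= r%:C%C).
Proof. by rewrite normcE lecR. Qed.

Lemma normc_ge0 (z : C) : 0 <= normc z.
Proof. by case: z => a b; exact: sqrtr_ge0. Qed.

Lemma normc_real (r : R) : normc r%:C%C = `|r|.
Proof. by rewrite /= expr0n /= addr0 sqrtr_sqr. Qed.

Lemma conj_real (r : R) : (r%:C%C : C)^* = r%:C%C.
Proof. exact: conjc_real. Qed.

Lemma sqr_norm2 n (x : 'cV[C]_n) : norm2 x ^+ 2 = \sum_i normc (x i 0) ^+ 2.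
Proof. by rewrite sqr_sqrtr // sumr_ge0 // => i _; exact: sqr_ge0. Qed.

Lemma norm2_sqn n (x : 'cV[C]_n) : (norm2 x ^+ 2)%:C%C = sqn x.
Proof. by rewrite sqr_norm2 rmorph_sum; apply: eq_bigr => i _;
  rewrite rmorphXn. Qed.

Lemma norm2_ge0 n (x : 'cV[C]_n) : 0 <= norm2 x.
Proof. exact: sqrtr_ge0. Qed.

Lemma norm2_eq_sqn m n (x : 'cV[C]_m) (y : 'cV[C]_n) :
  sqn x = sqn y -> norm2 x = norm2 y.
Proof.
rewrite -!norm2_sqn => /complexI/eqP; rewrite eqrXn2 ?norm2_ge0 //.
by move/eqP.
Qed.

Lemma norm2Z n (a : C) (x : 'cV[C]_n) : norm2 (a *: x) = normc a * norm2 x.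
Proof.
apply/eqP; rewrite -(@eqrXn2 _ 2) ?mulr_ge0 ?norm2_ge0 ?normc_ge0 //.
rewrite exprMn !sqr_norm2 mulr_sumr; apply/eqP/eq_bigr => i _.
by rewrite mxE normcM exprMn.
Qed.

Lemma norm2_eq0 n (x : 'cV[C]_n) : norm2 x = 0 -> x = 0.
Proof.
move=> x0; apply/colP => i; rewrite mxE; apply: eq0_normc; apply/eqP.
have := sqr_norm2 x; rewrite x0 expr0n /= => /esym/eqP.
rewrite psumr_eq0; last by move=> j _; exact: sqr_ge0.
by move/allP => /(_ i (mem_index_enum i)); rewrite /= sqrf_eq0.
Qed.

Lemma norm2_CauchySchwarz n (x y : 'cV[C]_n) :
  normc ((x ^t* *m y) 0 0) <= norm2 x * norm2 y.
Proof.
have [x0|x0] := eqVneq (norm2 x) 0.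
  by rewrite (norm2_eq0 x0) trmx0 map_mx0 mul0mx mxE normc0 mulr_ge0 ?norm2_ge0.
have [y0|y0] := eqVneq (norm2 y) 0.
  by rewrite (norm2_eq0 y0) mulmx0 mxE normc0 mulr_ge0 ?norm2_ge0.
have px : 0 < norm2 x by rewrite lt_def x0 norm2_ge0.
have py : 0 < norm2 y by rewrite lt_def y0 norm2_ge0.
apply: (@le_trans _ _ (\sum_i normc (x i 0) * normc (y i 0))).
  rewrite normc_le mxE; apply: le_trans (ler_norm_sum _ _ _) _.
  rewrite rmorph_sum; apply: ler_sum => i _ /=.
  by rewrite normrM !mxE norm_conjC rmorphM.
(* These weights balance the two sums of squares, so that the termwise mean inequality adds up to
   exactly |x| |y|. *)
have -> : norm2 x * norm2 y = \sum_i ((norm2 y / norm2 x * normc (x i 0) ^+ 2 +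
     norm2 x / norm2 y * normc (y i 0) ^+ 2) / 2).
  by rewrite -mulr_suml big_split /= -!mulr_sumr -!sqr_norm2; field; apply/andP.
apply: ler_sum => i _; move: (normc (x i 0)) (normc (y i 0)) => a b.
rewrite -subr_ge0.
have -> : (norm2 y / norm2 x * a ^+ 2 + norm2 x / norm2 y * b ^+ 2) / 2 - a * b
  =
  (norm2 y * a - norm2 x * b) ^+ 2 / (2 * norm2 x * norm2 y).
  by field; apply/andP.
by rewrite divr_ge0 ?sqr_ge0 // !mulr_ge0 // ltW.
Qed.

Lemma norm2D n (x y : 'cV[C]_n) : norm2 (x + y) <= norm2 x + norm2 y.
Proof.
rewrite -(@ler_pXn2r _ 2) ?nnegrE ?addr_ge0 ?norm2_ge0 // -lecR norm2_sqn sqnE.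
have -> : (x + y) ^t* *m (x + y) =
    x ^t* *m x + y ^t* *m y + (x ^t* *m y + y ^t* *m x).
  have -> : (x + y) ^t* = x ^t* + y ^t*.
    by apply/matrixP => i j; rewrite !mxE rmorphD.
  by rewrite mulmxDl !mulmxDr [y ^t* *m x + _]addrC addrACA.
have mxD (U V : 'M[C]_1) : (U + V) 0 0 = U 0 0 + V 0 0 by rewrite mxE.
rewrite !mxD -[X in _ <= X]/(_%:C%C) -!sqnE -!norm2_sqn -mxD.
have -> : ((norm2 x + norm2 y) ^+ 2)%:C%C =
    (norm2 x ^+ 2)%:C%C + (norm2 y ^+ 2)%:C%C +
    (norm2 x * norm2 y + norm2 y * norm2 x)%:C%C.
  by rewrite -!rmorphD; congr (_%:C%C); ring.
rewrite lerD2l.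
have conjD (u v : 'cV[C]_n) : ((u ^t* *m v) 0 0)^* = (v ^t* *m u) 0 0.
  by have := sform_conj u 1%:M v; rewrite /sform trmx1 map_mx1 !mulmx1.
have re : ((x ^t* *m y + y ^t* *m x) 0 0) \is Num.real.
  by apply/CrealP; rewrite mxD rmorphD /= !conjD addrC.
apply: le_trans (real_ler_norm re) _; rewrite mxE;
  apply: le_trans (ler_normD _ _) _.
by rewrite rmorphD lerD //= -normc_le norm2_CauchySchwarz.
Qed.

Lemma norm2N n (x : 'cV[C]_n) : norm2 (- x) = norm2 x.
Proof. by rewrite -scaleN1r norm2Z normcN normc1 mul1r. Qed.

Lemma norm2B n (x y : 'cV[C]_n) : norm2 (x - y) <= norm2 x + norm2 y.
Proof. by rewrite -(norm2N y) norm2D. Qed.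

Lemma norm2_mulmx_le m n (A : 'M[C]_(m, n)) (x : 'cV[C]_n) :
  norm2 (A *m x) <= spectral_norm A * norm2 x.
Proof.
have [x0|x0] := eqVneq (norm2 x) 0.
  rewrite x0 (norm2_eq0 x0) mulmx0 mulr0 -(scale0r 0) norm2Z normc0 mul0r //.
have px : 0 < norm2 x by rewrite lt_def x0 norm2_ge0.
have [_ hub] := spectral_norm_has_sup A.
rewrite -ler_pdivrMr //.
have -> : norm2 (A *m x) / norm2 x = norm2 (A *m ((norm2 x)^-1%:C%C *: x)).
  by rewrite -scalemxAr norm2Z normc_real ger0_norm ?invr_ge0 ?norm2_ge0 //
    mulrC.
apply: (ub_le_sup hub); exists ((norm2 x)^-1%:C%C *: x) => //=.
by rewrite norm2Z normc_real ger0_norm ?invr_ge0 ?norm2_ge0 // mulVf.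
Qed.

Lemma spectral_norm_le m n (A : 'M[C]_(m, n)) (c : R) : 0 <= c ->
  (forall x, norm2 (A *m x) <= c * norm2 x) -> spectral_norm A <= c.
Proof.
move=> c0 Ac; apply: ge_sup; first by case: (spectral_norm_has_sup A).
move=> _ [x /= x1 <-]; apply: le_trans (Ac x) _.
by rewrite -[leRHS]mulr1 ler_wpM2l.
Qed.

Lemma spectral_norm_ge0 m n (A : 'M[C]_(m, n)) : 0 <= spectral_norm A.
Proof.
have [_ hub] := spectral_norm_has_sup A.
apply: le_trans (norm2_ge0 (A *m 0)) _; apply: (ub_le_sup hub); exists 0 => //=.
by rewrite -(scale0r 0) norm2Z normc0 mul0r.
Qed.

(** Polarization: if y is the multiple of G x of length |x|, then 4 |x| |G x| is the form at x + y
    minus that at x - y, hence at most c (|x + y|^2 + |x - y|^2) = 4 c |x|^2. *)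
Lemma norm2_hermitian_le n (G : 'M[C]_n) (c : R) : G ^t* = G ->
  (forall x, normc (sform x G x) <= c * norm2 x ^+ 2) ->
  forall x, norm2 (G *m x) <= c * norm2 x.
Proof.
move=> Gh Gc x; have [y0|y0] := eqVneq (norm2 (G *m x)) 0.
  (* If G x = 0, what remains is c >= 0 for nonzero x, which the hypothesis at x gives. *)
  rewrite y0; have [x0|x0] := eqVneq (norm2 x) 0; first by rewrite x0 mulr0.
  have px : 0 < norm2 x by rewrite lt_def x0 norm2_ge0.
  rewrite mulr_ge0 ?norm2_ge0 // -(@pmulr_lge0 _ (norm2 x ^+ 2)) ?exprn_gt0 //.
  exact: le_trans (normc_ge0 _) (Gc x).
have x0 : norm2 x != 0.
  apply: contra_neq y0 => /norm2_eq0 ->.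
  by rewrite mulmx0 -(scale0r 0) norm2Z normc0 mul0r.
have px : 0 < norm2 x by rewrite lt_def x0 norm2_ge0.
have py : 0 < norm2 (G *m x) by rewrite lt_def y0 norm2_ge0.
pose t : R := norm2 x / norm2 (G *m x); pose y := t%:C%C *: (G *m x).
have ny : norm2 y = norm2 x.
  by rewrite norm2Z normc_real ger0_norm ?divr_ge0 ?norm2_ge0 // divfK.
have sD (K : 'M[C]_n) (u v : 'cV[C]_n) (e : C) : e^* = e -> e ^+ 2 = 1 ->
    sform (u + e *: v) K (u + e *: v) =
    sform u K u + sform v K v + e * (sform u K v + sform v K u).
  move=> eC e2; rewrite !sformE -!big_split /= mulr_sumr -big_split /=.
  apply: eq_bigr => i _; rewrite -!big_split /= mulr_sumr -big_split /=.
  apply: eq_bigr => j _; rewrite !mxE rmorphD rmorphM /= eC.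
  have -> : ((u i 0)^* + e * (v i 0)^*) * K i j * (u j 0 + e * v j 0) =
    (u i 0)^* * K i j * u j 0 + e ^+ 2 * ((v i 0)^* * K i j * v j 0) +
    e * ((u i 0)^* * K i j * v j 0 + (v i 0)^* * K i j * u j 0) by ring.
  by rewrite e2 mul1r.
have cross : sform x G y + sform y G x = (2 * (norm2 x * norm2 (G *m x)))%:C%C.
  have sy : sform y G x = (norm2 x * norm2 (G *m x))%:C%C.
    rewrite /sform -mulmxA.
    have -> : y ^t* = t%:C%C *: (G *m x) ^t*.
      apply/matrixP => i j; rewrite !mxE rmorphM /=; congr (_ * _).
      exact: conj_real.
    rewrite -scalemxAl mxE -sqnE -norm2_sqn -rmorphM; congr (_%:C%C).
    by rewrite /t; field.
  have -> : sform x G y = (sform y G x)^* by rewrite sform_conj Gh.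
  by rewrite sy conj_real -rmorphD; congr (_%:C%C); ring.
have sP K : sform (x + y) K (x + y) =
    sform x K x + sform y K y + (sform x K y + sform y K x).
  by have := sD K x y 1 (rmorph1 _) (expr1n _ _); rewrite scale1r mul1r.
have sB K : sform (x - y) K (x - y) =
    sform x K x + sform y K y - (sform x K y + sform y K x).
  by have := sD K x y (-1) (rmorphN1 _) (sqrr_sign _ 1);
    rewrite scaleN1r mulN1r.
have para : norm2 (x + y) ^+ 2 + norm2 (x - y) ^+ 2 = 4 * norm2 x ^+ 2.
  apply: complexI; rewrite rmorphD /= !norm2_sqn.
  have s1 (u : 'cV[C]_n) : sqn u = sform u 1%:M u by rewrite /sform mulmx1 sqnE.
  rewrite !s1 sP sB -!s1 -!norm2_sqn ny.
  rewrite addrACA subrr addr0 -!rmorphD; congr (_%:C%C); ring.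
have e4 : (4 * (norm2 x * norm2 (G *m x)))%:C%C =
    sform (x + y) G (x + y) - sform (x - y) G (x - y).
  rewrite sB sP cross; set a := norm2 x * _.
  have -> : 4 * a = 2 * a + 2 * a by ring.
  by rewrite rmorphD /=; ring.
have : 4 * (norm2 x * norm2 (G *m x)) <= 4 * (norm2 x * (c * norm2 x)).
  have -> : 4 * (norm2 x * (c * norm2 x)) =
      c * norm2 (x + y) ^+ 2 + c * norm2 (x - y) ^+ 2 by rewrite -mulrDr para;
        ring.
  rewrite -lecR e4; apply: le_trans (real_ler_norm _) _.
    by rewrite rpredB // sform_real.
  apply: le_trans (ler_normB _ _) _; rewrite rmorphD.
  by rewrite lerD //= -normc_le.
by rewrite ler_pM2l // ler_pM2l.
Qed.

End Norm.

(** * Resolvents and moments *)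

Section Resolvent.
Import Normc.
Variables (R : realType) (n : nat).
Local Notation C := R[i].
Variable A : 'M[C]_n.+1.

(** The Neumann series cut at T, with its exact remainder, by telescoping. *)
Lemma resolvent_geometric (z : C) T : z != 0 -> z%:M - A \in unitmx ->
  \sum_(j < T) z ^- j.+1 *: A ^+ j = invmx (z%:M - A) *m (1 - z ^- T *: A ^+ T).
Proof.
move=> z0 Uz; rewrite -[LHS]mul1mx -(mulVmx Uz) -mulmxA; congr (_ *m _).
rewrite mulmxE mulr_sumr -(big_mkord xpredT (fun j =>
  (z%:M - A) * (z ^- j.+1 *: A ^+ j))).
elim: T => [|T IHT]; first by rewrite big_geq // !expr0 invr1 scale1r subrr.
rewrite big_nat_recr //= IHT mulrBl -!scalerAr -exprS -(scalemx1 _ z) -scalerAl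
  mul1r.
have zT : z ^- T.+1 * z = z ^- T by rewrite [z ^+ _]exprS invfM mulrC mulVKf.
by rewrite scalerA zT addrA subrK.
Qed.

(** Induction on the linear factors of the characteristic polynomial, which kills A by
    Cayley-Hamilton: without the factor A - z, the product still kills (A - z) x, and A^(k+1) x = z
    A^k x + A^k (A - z) x with |z| <= 1. *)
Lemma norm2_power_le (s : R) (x : 'cV[C]_n.+1) : 1 < s ->
  (forall z : C, eigenvalue A z -> `|z| <= 1) ->
  exists2 c : R, 0 <= c & forall k, norm2 (A ^+ k *m x) <= c * s ^+ k.
Proof.
move=> s1 specA; have [r Dp] := closed_field_poly_normal (char_poly A).
rewrite (monicP (char_poly_monic A)) scale1r in Dp.
have r1 : all (fun z : C => normc z <= 1) r.
  apply/allP => z zr; rewrite normc_le; apply: specA.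
  by rewrite eigenvalue_root_char Dp root_prod_XsubC.
have : horner_mx A (\prod_(z <- r) ('X - z%:P)) *m x = 0.
  by rewrite -Dp Cayley_Hamilton mul0mx.
elim: r r1 x {Dp} => [_ x|z r IHr /= /andP [z1 r1] x].
  rewrite big_nil rmorph1 mul1mx => ->; exists 0 => // k.
  by rewrite mulmx0 mul0r -(scale0r 0) norm2Z normc0 mul0r.
rewrite big_cons mulrC rmorphM rmorphB /= horner_mx_X horner_mx_C -mulmxE
  -mulmxA.
case/(IHr r1) => c c0 IHc; exists (norm2 x + c / (s - 1)) => [|k].
  by rewrite addr_ge0 ?norm2_ge0 // divr_ge0 // subr_ge0 ltW.
have sk m : 1 <= s ^+ m by rewrite exprn_ege1 // ltW.
(* The contributions c s^i add up to a geometric sum; this sharper form passes through the induction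
   on k. *)
suff h : norm2 (A ^+ k *m x) <= norm2 x + c / (s - 1) * (s ^+ k - 1).
  apply: le_trans h _; rewrite mulrDl; apply: lerD.
    by rewrite ler_peMr ?norm2_ge0.
  by rewrite ler_wpM2l ?gerBl ?ler01 // divr_ge0 // subr_ge0 ltW.
elim: k => [|k IHk]; first by rewrite expr0 mul1mx subrr mulr0 addr0.
have -> : A ^+ k.+1 *m x = z *: (A ^+ k *m x) + A ^+ k *m ((A - z%:M) *m x).
  rewrite mulmxBl mulmxBr mul_scalar_mx -scalemxAr addrC subrK exprSr.
  by rewrite -mulmxE mulmxA.
apply: le_trans (norm2D _ _) _; rewrite norm2Z.
have -> : norm2 x + c / (s - 1) * (s ^+ k.+1 - 1) =
   norm2 x + c / (s - 1) * (s ^+ k - 1) + c * s ^+ k.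
  by rewrite exprS; field; rewrite subr_eq0 gt_eqF.
by apply: lerD (IHc k); apply: le_trans IHk; rewrite ler_piMl ?norm2_ge0.
Qed.

Definition moment (rho : R) (J : 'M[C]_n.+1) (x : 'cV[C]_n.+1) j : C :=
  (rho%:C%C) ^- j * sform x (J *m A ^+ j) x.

(** The vector (A/rho)^j x: the remainder of the truncated resolvent at j = T, and column j of the
    factor [W] of the Hankel matrix. *)
Definition tail (rho : R) (x : 'cV[C]_n.+1) j : 'cV[C]_n.+1 :=
  (rho%:C%C) ^- j *: (A ^+ j *m x).

(** At z = rho / w one has z^-T = rho^-T, so the truncated symbol is z times the inner product of J
    x with (z - A)^-1 (x - rho^-T A^T x), with the same remainder for all w. *)
Lemma moment_symbol_le (rho kap : R) (J : 'M[C]_n.+1) (x : 'cV[C]_n.+1) T :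
  0 < rho -> (0 < T)%N -> J ^t* = J -> norm2 (J *m x) = norm2 x ->
  (forall z : C, normc z = rho -> (z%:M - A \in unitmx) /\
      spectral_norm (invmx (z%:M - A)) <= kap) ->
  forall w, w ^+ T = 1 -> `|\sum_(j < T) moment rho J x j * w ^+ j| <=
     (rho * kap * norm2 x * norm2 (x - tail rho x T))%:C%C.
Proof.
move=> rho0 T0 Jh Jx Hres w wT; have w1 := norm_unity_root T0 wT.
have w0 : w != 0 by rewrite -normr_eq0 w1 oner_eq0.
have r0 : rho%:C%C != 0 :> C.
  by apply/eqP => /complexI r0; rewrite r0 ltxx in rho0.
pose z : C := rho%:C%C / w.
have z0 : z != 0 by rewrite mulf_neq0 ?invr_eq0.
have nz : normc z = rho.
  rewrite normcM normcV normc_real gtr0_norm //.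
  have -> : normc w = 1 by apply: complexI; exact: w1.
  by rewrite invr1 mulr1.
have [Uz Kz] := Hres z nz.
have -> : \sum_(j < T) moment rho J x j * w ^+ j =
    z * ((J *m x) ^t* *m (invmx (z%:M - A) *m (x - tail rho x T))) 0 0.
  have -> : x - tail rho x T = (1 - z ^- T *: A ^+ T) *m x.
    rewrite mulmxBl mul1mx -scalemxAl /tail; congr (_ - _ *: _).
    by rewrite /z expr_div_n wT divr1.
  rewrite (mulmxA (invmx _)) -resolvent_geometric //.
  rewrite mulmx_suml mulmx_sumr summxE mulr_sumr; apply: eq_bigr => j _.
  rewrite -scalemxAl -scalemxAr mxE [z ^+ j.+1]exprS invfM -[z^-1 * _ * _]mulrA
    mulVKf //.
  rewrite /moment /z expr_div_n invf_div mulrAC [_ * w ^+ j]mulrC.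
  by rewrite [_ ^t*]trmxC_mul Jh /sform !mulmxA.
rewrite -normc_le normcM nz -!mulrA ler_pM2l //.
apply: le_trans (norm2_CauchySchwarz _ _) _; rewrite Jx.
rewrite [leRHS]mulrCA ler_wpM2l ?norm2_ge0 //.
by apply: le_trans (norm2_mulmx_le _ _) _; rewrite ler_wpM2r ?norm2_ge0.
Qed.

End Resolvent.

(** * Eigenvalues and spectral projections of an involution *)

Section Involution.
Variables (R : realType) (n : nat).
Local Notation C := R[i].
Variable J : 'M[C]_n.+1.
Hypothesis JJ : J *m J = 1%:M.

Lemma involution_eigenvalues :
  [/\ size (eigenvalues J) = n.+1, \sum_(z <- eigenvalues J) z = \tr J &
      forall z, z \in eigenvalues J -> (z == 1) || (z == -1)].
Proof.
rewrite /eigenvalues; case: closed_field_poly_normal => r /= Dp.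
rewrite (monicP (char_poly_monic J)) scale1r in Dp.
have sr : size r = n.+1.
  by apply: succn_inj; rewrite -(size_prod_XsubC r id) -Dp size_char_poly.
split => // [|z zr].
  have := char_poly_trace J (ltn0Sn n); rewrite Dp.
  have -> : n.+1.-1 = (size r).-1 by rewrite sr.
  by rewrite coefPn_prod_XsubC ?sr // => /oppr_inj.
have : eigenvalue J z by rewrite eigenvalue_root_char Dp root_prod_XsubC.
case/eigenvalueP => v vJ v0; rewrite -eqf_sqr expr1n -subr_eq0.
have : (z ^+ 2 - 1) *: v = 0.
  by rewrite scalerBl scale1r expr2 -scalerA -vJ scalemxAl -vJ -mulmxA JJ
    mulmx1 subrr.
by move/eqP; rewrite scaler_eq0 (negbTE v0) orbF.
Qed.

Lemma mxtrace_involution : \tr J = n.+1%:R - 2 * (neg_index J)%:R.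
Proof.
have [] := involution_eigenvalues; rewrite /neg_index.
move: (eigenvalues J) => s sz <-; rewrite -sz; elim: s {sz} => [_|z r IHr Hr].
  by rewrite big_nil mulr0 subr0.
have {}IHr := IHr (fun y yr => Hr y (mem_behead (s := z :: r) yr)).
rewrite big_cons IHr /= natrD -[(size r).+1%:R]natr1.
have /orP[/eqP-> | /eqP->] := Hr z (mem_head _ _).
  by rewrite ltr10 /=; ring.
by rewrite oppr_lt0 ltr01 /=; ring.
Qed.

Lemma neg_index_le : (neg_index J <= n.+1)%N.
Proof.
by have [sz _ _] := involution_eigenvalues; rewrite -{2}sz count_size.
Qed.

(** This matrix is idempotent, so its rank is its trace, which counts the eigenvalues -1. *)
Lemma rank_neg_proj : \rank (2^-1 *: (1%:M - J)) = neg_index J.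
Proof.
apply/eqP; rewrite -(eqr_nat C) -mxtrace_idem.
  by rewrite mxtraceZ raddfB /= mxtrace1 mxtrace_involution; apply/eqP; field.
rewrite -scalemxAl -scalemxAr mulmxBl mul1mx mulmxBr mulmx1 JJ.
by congr (_ *: _); apply/matrixP => i j; rewrite !mxE; field.
Qed.

Lemma rank_pos_proj : \rank (2^-1 *: (1%:M + J)) = (n.+1 - neg_index J)%N.
Proof.
apply/eqP; rewrite -(eqr_nat C) -mxtrace_idem.
  rewrite mxtraceZ raddfD /= mxtrace1 mxtrace_involution natrB ?neg_index_le //.
  by apply/eqP; field.
rewrite -scalemxAl -scalemxAr mulmxDl mul1mx mulmxDr mulmx1 JJ.
by congr (_ *: _); apply/matrixP => i j; rewrite !mxE; field.
Qed.

End Involution.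

(** * Decay of the moments and factorizations of their Hankel matrix *)

Section Moments.
Import Normc.
Variables (R : realType) (n : nat).
Local Notation C := R[i].
Variable A : 'M[C]_n.+1.

Lemma norm2_tail (rho : R) (x : 'cV[C]_n.+1) j : 0 < rho ->
  norm2 (tail A rho x j) = rho ^- j * norm2 (A ^+ j *m x).
Proof.
move=> r0; rewrite /tail norm2Z -rmorphXn -fmorphV normc_real.
by rewrite gtr0_norm ?invr_gt0 ?exprn_gt0.
Qed.

(** The factor j + 1 is there to cover the weight L of the second block of the flip. *)
Lemma tail_small (rho : R) (x : 'cV[C]_n.+1) (e : R) : 1 < rho -> 0 < e ->
  (forall z : C, eigenvalue A z -> `|z| <= 1) ->
  exists m, forall j, (m <= j)%N -> j.+1%:R * norm2 (tail A rho x j) <= e.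
Proof.
move=> r1 e0 specA; have r0 : 0 < rho by lra.
(* Chosen so that 1 < s and s^2 < rho: one s^j bounds the growth of A^j x, the other the linear
   weight (by Bernoulli), and (s^2 / rho)^j tends to 0. *)
pose s := Num.sqrt ((1 + rho) / 2).
have s2 : s ^+ 2 = (1 + rho) / 2 by rewrite sqr_sqrtr //; lra.
have s0 : 0 <= s by exact: sqrtr_ge0.
have s1 : 1 < s.
  by rewrite -(@ltr_pXn2r _ 2) ?nnegrE ?ler01 // expr1n s2; lra.
have [c c0 Hc] := norm2_power_le x s1 specA.
pose th := s ^+ 2 / rho.
have th0 : 0 <= th by rewrite divr_ge0 ?sqr_ge0 // ltW.
have th1 : `|th| < 1 by rewrite ger0_norm // ltr_pdivrMr // s2; lra.
pose B := c * (1 + (s - 1)^-1) + 1.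
have d0 : 0 < (s - 1)^-1 by rewrite invr_gt0 subr_gt0.
have B0 : 0 < B by rewrite ltr_wpDl // mulr_ge0 // addr_ge0 // ltW.
have /cvgrPdist_le/(_ (e / B)) := cvg_expr th1.
case=> [|m _ Hm]; first by rewrite divr_gt0.
exists m => j mj; have := Hm j mj; rewrite sub0r normrN ger0_norm ?exprn_ge0 //.
rewrite ler_pdivlMr // mulrC; apply: le_trans.
have sj : j.+1%:R <= (1 + (s - 1)^-1) * s ^+ j.
  have bern : 1 + j%:R * (s - 1) <= s ^+ j.
    elim: j {mj} => [|j IHj]; first by rewrite mul0r addr0.
    rewrite exprS -natr1; apply: (@le_trans _ _ (s * (1 + j%:R * (s - 1)))).
      rewrite -subr_ge0.
      have -> : s * (1 + j%:R * (s - 1)) - (1 + (j%:R + 1) * (s - 1)) =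
        j%:R * (s - 1) ^+ 2 by ring.
      by rewrite mulr_ge0 ?sqr_ge0.
    by rewrite ler_wpM2l.
  have ge1 : 1 <= s ^+ j by rewrite exprn_ege1 // ltW.
  rewrite -natr1 mulrDl mul1r addrC lerD //.
  by rewrite ler_pdivlMl ?subr_gt0 // mulrC; lra.
rewrite norm2_tail //.
apply: (@le_trans _ _ ((1 + (s - 1)^-1) * s ^+ j * (rho ^- j * (c * s ^+ j)))).
  apply: ler_pM => //; rewrite ?mulr_ge0 ?invr_ge0 ?exprn_ge0 ?norm2_ge0 //;
    try lra.
  by rewrite ler_wpM2l ?invr_ge0 ?exprn_ge0 //; lra.
have -> : (1 + (s - 1)^-1) * s ^+ j * (rho ^- j * (c * s ^+ j)) = (B - 1) * th
  ^+ j.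
  by rewrite /B /th addrK expr_div_n -exprM mulnC exprM expr2; ring.
by rewrite ler_wpM2r ?exprn_ge0 // gerBl.
Qed.

Lemma normc_moment_le (rho : R) (J : 'M[C]_n.+1) (x : 'cV[C]_n.+1) j :
  J ^t* = J -> norm2 (J *m x) = norm2 x ->
  normc (moment A rho J x j) <= norm2 x * norm2 (tail A rho x j).
Proof.
move=> Jh Jx.
have -> : moment A rho J x j = ((J *m x) ^t* *m tail A rho x j) 0 0.
  by rewrite [_ ^t*]trmxC_mul Jh /tail -scalemxAr mxE /moment /sform !mulmxA.
by apply: le_trans (norm2_CauchySchwarz _ _) _; rewrite Jx.
Qed.

(** A^j is a combination of the first d powers of A; expanding it inside A^(i+j) separates i from j
    through d terms. *)
Lemma moment_matrix_rank (rho : R) (J : 'M[C]_n.+1) (x : 'cV[C]_n.+1) N :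
  let d := degree_mxminpoly A in
  exists K1 : 'M[C]_(N, d), exists K2 : 'M[C]_(d, N),
    \matrix_(i, j) moment A rho J x (i + j)%N = K1 *m K2.
Proof.
move=> d; pose u j : 'rV[C]_d := mxvec (A ^+ j) *m pinvmx (powers_mx A d).
have uE j : A ^+ j = \sum_(l < d) u j 0 l *: A ^+ l.
  have := horner_mx_mem A ('X^j); rewrite rmorphXn /= horner_mx_X => Aj.
  rewrite -[LHS]mxvecK -(mulmxKpV Aj) mulmx_sum_row linear_sum.
  by apply: eq_bigr => l _; rewrite linearZ /= rowK mxvecK.
exists (\matrix_(i, l) ((rho%:C%C) ^- i * sform x (J *m A ^+ (i + l)%N) x)).
exists (\matrix_(l, j) ((rho%:C%C) ^- j * u j 0 l)).
apply/matrixP => i j; rewrite [LHS]mxE [RHS]mxE /moment !exprD (uE j).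
rewrite /sform -mulmxE !mulmx_sumr mulmx_suml summxE mulr_sumr.
apply: eq_bigr => l _; rewrite [X in _ = X * _]mxE [X in _ = _ * X]mxE.
move: (u j 0 l) => a; rewrite exprD invfM -!scalemxAr -scalemxAl.
by rewrite -mulmxE !mulmxA [X in _ * X = _]mxE; ring.
Qed.

(** J-selfadjointness moves A^i across the form, so this is the Gram matrix, for the form J, of the
    vectors (A/rho)^j x; the scalars are real. *)
Lemma moment_matrix_isometry (rho : R) (J : 'M[C]_n.+1) (x : 'cV[C]_n.+1) L :
  A ^t* *m J = J *m A ->
  let W := \matrix_(i < n.+1, j < L) tail A rho x j i 0 in
  \matrix_(i < L, j < L) moment A rho J x (i + j)%N = W ^t* *m J *m W.
Proof.
move=> AJ W; apply/matrixP => i j; rewrite -sform_col mxE.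
have colW l : col l W = tail A rho x l by apply/colP => m; rewrite !mxE.
have AJp l : (A ^+ l) ^t* *m J = J *m A ^+ l.
  elim: l => [|l IHl]; first by rewrite expr0 trmx1 map_mx1 mul1mx mulmx1.
  have -> : (A ^+ l.+1) ^t* = (A ^+ l) ^t* *m A ^t*.
    by rewrite exprS -mulmxE trmxC_mul.
  by rewrite -mulmxA AJ mulmxA IHl -mulmxA exprSr.
rewrite !colW /tail /sform -scalemxAr mxE.
have -> : ((rho%:C%C) ^- i *: (A ^+ i *m x)) ^t* = (rho%:C%C) ^- i *: (x ^t* *m
  (A ^+ i) ^t*).
  rewrite -trmxC_mul; apply/matrixP => a b; rewrite !mxE rmorphM /=;
    congr (_ * _).
  by rewrite -rmorphXn -fmorphV; exact: conj_real.
rewrite -!scalemxAl mxE -!mulmxA (mulmxA _ J) AJp /moment /sform exprD invfM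
  mulrCA mulrA.
by rewrite !mulmxA exprD -mulmxE !mulmxA.
Qed.

End Moments.

(** * Moment bounds from the resolvent on one circle *)

Section Bounds.
Import Normc.
Variables (R : realType) (n : nat).
Local Notation C := R[i].
Variables (A J : 'M[C]_n.+1) (rho kap : R).
Hypothesis specA : forall z : C, eigenvalue A z -> `|z| <= 1.
Hypothesis Jh : J ^t* = J.
Hypothesis JJ : J *m J = 1%:M.
Hypothesis AJ : A ^t* *m J = J *m A.
Hypothesis rho1 : 1 < rho.
Hypothesis Hres : forall z : C, normc z = rho ->
  (z%:M - A \in unitmx) /\ spectral_norm (invmx (z%:M - A)) <= kap.

Lemma norm2_involution (x : 'cV[C]_n.+1) : norm2 (J *m x) = norm2 x.
Proof.
apply: norm2_eq_sqn; rewrite !sqnE trmxC_mul Jh mulmxA.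
by rewrite -(mulmxA _ J J) JJ mulmx1.
Qed.

Lemma ler_addMgt0 (a b B : R) : 0 <= B ->
  (forall e, 0 < e -> a <= b + B * e) -> a <= b.
Proof.
move=> B0 H; apply/ler_addgt0Pr => e e0.
have B1 : 0 < B + 1 by rewrite ltr_wpDl.
apply: le_trans (H (e / (B + 1)) _) _; first by rewrite divr_gt0.
rewrite lerD2l mulrCA; apply: ler_piMr; first exact: ltW.
by rewrite ler_pdivrMr // mul1r lerDl.
Qed.

Let rho_gt0 : 0 < rho.
Proof. exact: lt_trans ltr01 rho1. Qed.

Lemma resolvent_bound_ge0 : 0 <= kap.
Proof.
have [|_] := Hres (z := rho%:C%C); first by rewrite normc_real gtr0_norm //
  rho_gt0.
exact/le_trans/spectral_norm_ge0.
Qed.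

(** The rank estimate at N = k + 1, with the truncation error e sent to 0. *)
Lemma moment_bound_degree (x : 'cV[C]_n.+1) k :
  k.+1%:R * normc (moment A rho J x k) <=
    (degree_mxminpoly A)%:R * (rho * kap * norm2 x ^+ 2).
Proof.
have r0 := rho_gt0.
set d := degree_mxminpoly A.
have k0 := resolvent_bound_ge0; have x0 := norm2_ge0 x.
have M0 : 0 <= rho * kap * norm2 x by rewrite !mulr_ge0 // ltW.
apply: (@ler_addMgt0 _ _ (d%:R * (rho * kap * norm2 x))).
  by rewrite mulr_ge0.
move=> e e0; have [m Hm] := tail_small x rho1 e0 specA.
(* Large enough for a Hankel matrix of size k + 1 and for a remainder below e. *)
pose T := (m + 2 * k.+1)%N.
have T0 : (0 < T)%N by rewrite /T; lia.
have kT : (2 * k.+1 <= T)%N by rewrite /T; lia.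
have [K1 [K2 HK]] := moment_matrix_rank A rho J x k.+1.
have := hankel_corner_rank (ltn0Sn k) kT
  (moment_symbol_le r0 T0 Jh (norm2_involution x) Hres) HK.
have -> : `|k.+1%:R * moment A rho J x k.+1.-1| =
    (k.+1%:R * normc (moment A rho J x k))%:C%C.
  by rewrite normrM normr_nat [RHS]rmorphM rmorph_nat.
rewrite -(rmorph_nat (real_complex R)) -rmorphM lecR => /le_trans; apply.
have -> : d%:R * (rho * kap * norm2 x ^+ 2) + d%:R * (rho * kap * norm2 x) * e =
   d%:R * (rho * kap * norm2 x * (norm2 x + e)) by ring.
rewrite ler_wpM2l // ler_wpM2l //; apply: le_trans (norm2B _ _) _;
  rewrite lerD2l.
apply: le_trans (Hm T _); last by rewrite /T; lia.
by rewrite ler_peMl ?norm2_ge0 // ler1n.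
Qed.

(** Two errors vanish with e: the remainder of the symbol at 2 L, and the moment of index k + L from
    the second block. *)
Lemma moment_bound_isometry r (F : 'M[C]_(r, n.+1)) (x : 'cV[C]_n.+1) k :
  (forall y : 'cV_n.+1, F *m y = 0 -> J *m y = y) ->
  k.+1%:R * normc (moment A rho J x k) <=
    (2 * r + 1)%:R * (rho * kap * norm2 x ^+ 2).
Proof.
move=> FJ; have r0 := rho_gt0.
set d : nat := (2 * r + 1)%N.
have k0 := resolvent_bound_ge0; have x0 := norm2_ge0 x.
have M0 : 0 <= rho * kap * norm2 x by rewrite !mulr_ge0 // ltW.
apply: (@ler_addMgt0 _ _ (d%:R * (rho * kap * norm2 x) + norm2 x)).
  by rewrite addr_ge0 // mulr_ge0.
move=> e e0; have [m Hm] := tail_small x rho1 e0 specA.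
pose L := (m + k.+1)%N.
have T0 : (0 < 2 * L)%N by rewrite /L; lia.
have kL : (0 < k.+1 <= L)%N by rewrite /L; lia.
have := hankel_corner_isometry kL
  (moment_symbol_le r0 T0 Jh (norm2_involution x) Hres) Jh FJ
  (moment_matrix_isometry rho x L AJ).
have -> : `|k.+1%:R * moment A rho J x k.+1.-1| =
    (k.+1%:R * normc (moment A rho J x k))%:C%C.
  by rewrite normrM normr_nat [RHS]rmorphM rmorph_nat.
have -> (i : nat) : `|L%:R * moment A rho J x i| =
    (L%:R * normc (moment A rho J x i))%:C%C.
  by rewrite normrM normr_nat [RHS]rmorphM rmorph_nat.
rewrite -/d -(rmorph_nat (real_complex R) d) -rmorphM -rmorphD lecR =>
  /le_trans; apply.
rewrite mulrDl addrA lerD //.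
  have -> : d%:R * (rho * kap * norm2 x ^+ 2) + d%:R * (rho * kap * norm2 x) *
    e =
     d%:R * (rho * kap * norm2 x * (norm2 x + e)) by ring.
  rewrite ler_wpM2l // ler_wpM2l //; apply: le_trans (norm2B _ _) _;
    rewrite lerD2l.
  apply: le_trans (Hm (2 * L)%N _); last by rewrite /L; lia.
  by rewrite ler_peMl ?norm2_ge0 // ler1n.
apply: (@le_trans _ _ (L%:R * (norm2 x * norm2 (tail A rho x (k.+1 +
  L.-1)%N)))).
  by rewrite ler_wpM2l // normc_moment_le // norm2_involution.
(* At j = k + L one has L <= j + 1, so [tail_small] absorbs the weight L. *)
rewrite mulrCA ler_wpM2l //; apply: le_trans (Hm (k.+1 + L.-1)%N _); last first.
  by rewrite /L; lia.
by rewrite ler_wpM2r ?norm2_ge0 // ler_nat /L; lia.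
Qed.

End Bounds.

(** * From moments to the norms of powers *)

Section Kreiss.
Import Normc.
Variables (R : realType) (n : nat).
Local Notation C := R[i].
Variables (A J : 'M[C]_n.+1).
Hypothesis specA : forall z : C, eigenvalue A z -> `|z| <= 1.
Hypothesis Jh : J ^t* = J.
Hypothesis JJ : J *m J = 1%:M.
Hypothesis AJ : A ^t* *m J = J *m A.

Lemma resolvent_unit (z : C) : 1 < normc z -> z%:M - A \in unitmx.
Proof.
move=> z1; rewrite unitmxE unitfE; apply/det0P => -[v v0 /eqP].
rewrite mulmxBr mul_mx_scalar subr_eq0 eq_sym => /eqP vA.
have : eigenvalue A z by apply/eigenvalueP; exists v.
by move/specA; rewrite -normc_le leNgt z1.
Qed.

(** For [F] a row basis of (1 - J)/2 is taken, so that its number of rows is the rank, that is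
    [neg_index J]; passing to - J only changes the sign of the moments and leads to the rank of (1 +
    J)/2. *)
Lemma moment_bound_nu (rho kap : R) (x : 'cV[C]_n.+1) k : 1 < rho ->
  (forall z : C, normc z = rho ->
    (z%:M - A \in unitmx) /\ spectral_norm (invmx (z%:M - A)) <= kap) ->
  k.+1%:R * normc (moment A rho J x k) <= (nu J A)%:R * (rho * kap * norm2 x ^+
    2).
Proof.
move=> rho1 Hres.
have proj0 (P : 'M[C]_n.+1) (y : 'cV[C]_n.+1) : row_base P *m y = 0 -> P *m y =
  0.
  by move=> Py; rewrite -(mulmx_base P) -mulmxA Py mulmx0.
have split (y : 'cV[C]_n.+1) (K : 'M[C]_n.+1) :
    (2^-1 *: (1%:M - K)) *m y = 0 -> K *m y = y.
  rewrite -scalemxAl mulmxBl mul1mx => /eqP;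
    rewrite scaler_eq0 invr_eq0 pnatr_eq0 /=.
  by rewrite subr_eq0 eq_sym => /eqP.
have hd := moment_bound_degree specA Jh JJ rho1 Hres x k.
have hn := moment_bound_isometry specA Jh JJ AJ rho1 Hres x k
  (fun y Fy => split y J (proj0 _ y Fy)).
have hp : k.+1%:R * normc (moment A rho J x k) <=
    (2 * (n.+1 - neg_index J) + 1)%:R * (rho * kap * norm2 x ^+ 2).
  have NJh : (- J) ^t* = - J by rewrite raddfN /= map_mxN Jh.
  have NJJ : (- J) *m (- J) = 1%:M by rewrite mulNmx mulmxN opprK.
  have NAJ : A ^t* *m (- J) = - J *m A by rewrite mulNmx mulmxN AJ.
  have := moment_bound_isometry specA NJh NJJ NAJ rho1 Hres x k
    (fun y Fy => split y (- J) (proj0 _ y Fy)).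
  have -> : moment A rho (- J) x k = - moment A rho J x k.
    by rewrite /moment /sform mulNmx mulmxN mulNmx mxE mulrN.
  by rewrite normcN opprK rank_pos_proj.
rewrite rank_neg_proj // in hn.
by rewrite /nu /minn; do ![case: ifP => _].
Qed.

(** On |z| = rho = 1 + 1/k the resolvent is at most k K; rho k K = (k + 1) K cancels the factor k +
    1 of the moment bound, and undoing the scaling rho^-k leaves rho^k. *)
Lemma spectral_norm_power_le (K : R) k : (0 < k)%N -> 0 <= K ->
  (forall z : C, 1 < normc z ->
     (normc z - 1) * spectral_norm (invmx (z%:M - A)) <= K) ->
  spectral_norm (A ^+ k) <= (nu J A)%:R * (1 + k%:R^-1) ^+ k * K.
Proof.
move=> k0 K0 HK; pose rho : R := 1 + k%:R^-1.
have kR : 0 < k%:R :> R by rewrite ltr0n.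
have rho1 : 1 < rho by rewrite ltrDl invr_gt0.
have r0 : 0 < rho by exact: lt_trans ltr01 rho1.
have Hres z : normc z = rho -> (z%:M - A \in unitmx) /\
    spectral_norm (invmx (z%:M - A)) <= k%:R * K.
  move=> zr; split; first by apply: resolvent_unit; rewrite zr.
  have := HK z; rewrite zr => /(_ rho1).
  by rewrite /rho addrC addKr ler_pdivrMl.
have rk : rho * k%:R = k.+1%:R by rewrite mulrDl mul1r mulVf ?gt_eqF // -natr1.
have B0 : 0 <= (nu J A)%:R * rho ^+ k * K by rewrite !mulr_ge0 ?exprn_ge0 //
  ltW.
have JAh : (J *m A ^+ k) ^t* = J *m A ^+ k.
  elim: (k) => [|j IHj]; first by rewrite expr0 mulmx1.
  have -> : J *m A ^+ j.+1 = J *m A ^+ j *m A by rewrite exprSr -mulmxE mulmxA.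
  rewrite trmxC_mul IHj mulmxA AJ -!mulmxA; congr (_ *m _).
  by rewrite !mulmxE -exprS -exprSr.
apply: spectral_norm_le => // x.
rewrite -(norm2_involution Jh JJ) mulmxA.
apply: norm2_hermitian_le => // y.
have := moment_bound_nu y k rho1 Hres.
have -> : normc (moment A rho J y k) = rho ^- k * normc (sform y (J *m A ^+ k)
  y).
  rewrite /moment normcM -rmorphXn -fmorphV normc_real ger0_norm //.
  by rewrite invr_ge0 exprn_ge0 // ltW.
have -> : rho * (k%:R * K) = k.+1%:R * K by rewrite mulrA rk.
rewrite -!mulrA [leRHS]mulrCA ler_pM2l // ler_pdivrMl ?exprn_gt0 //.
by rewrite [leRHS]mulrCA.
Qed.

End Kreiss.

(** * Extended values, the zeroth power and the constant e *)

Section Final.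
Import Normc.
Variables (R : realType) (n : nat).
Local Notation C := R[i].
Implicit Types A J : 'M[C]_n.+1.

Lemma nu_gt0 J A : (0 < nu J A)%N.
Proof. by rewrite /nu !leq_min mxminpoly_nonconstant !addn1. Qed.

Lemma kreiss_ub A (z : C) : 1 < normc z ->
  (((normc z - 1) * spectral_norm (invmx (z%:M - A)))%:E <= kreiss A)%E.
Proof. by move=> z1; apply: ereal_sup_ubound; exists z. Qed.

Lemma kreiss_ge0 A : (0 <= kreiss A)%E.
Proof.
have z1 : 1 < normc (2%:R%:C%C : C) by rewrite normc_real normr_nat ltr1n.
apply: le_trans (kreiss_ub A z1).
by rewrite lee_fin mulr_ge0 ?spectral_norm_ge0 // subr_ge0 ltW.
Qed.

Lemma spectral_norm1_le : spectral_norm (1%:M : 'M[C]_n.+1) <= 1.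
Proof. by apply: spectral_norm_le => // x; rewrite mul1mx mul1r. Qed.

(* As [z] tends to infinity, [(|z| - 1) |(z - A)^-1|] tends to 1; the point
   [|z| = |A| + 2] already gives 1/2. *)
Lemma half_le_kreiss A (K : R) :
  (forall z : C, eigenvalue A z -> `|z| <= 1) ->
  (forall z : C, 1 < normc z ->
     (normc z - 1) * spectral_norm (invmx (z%:M - A)) <= K) -> 2^-1 <= K.
Proof.
move=> specA HK; pose a := spectral_norm A;
  have a0 : 0 <= a := spectral_norm_ge0 A.
have nz : normc ((a + 2)%:C%C : C) = a + 2.
  by rewrite normc_real ger0_norm // addr_ge0.
have z1 : 1 < normc ((a + 2)%:C%C : C) by rewrite nz; lra.
have Uz := resolvent_unit specA z1; have := HK _ z1; rewrite nz.
move: Uz; set z : C := (a + 2)%:C%C; set S := invmx _ => Uz.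
apply: le_trans; pose x : 'cV[C]_n.+1 := delta_mx 0 0.
have x0 : 0 < norm2 x.
  rewrite lt_def norm2_ge0 andbT; apply/eqP => /norm2_eq0/colP/(_ 0).
  by rewrite !mxE !eqxx => /eqP; rewrite oner_eq0.
(* |z| + |A| = 2 (a + 1) while |z| - 1 = a + 1: the quotient is 1/2. *)
have zx : norm2 ((z%:M - A) *m x) <= (2 * (a + 1)) * norm2 x.
  rewrite mulmxBl mul_scalar_mx; apply: le_trans (norm2B _ _) _.
  rewrite norm2Z nz; have := norm2_mulmx_le A x; rewrite -/a; nra.
have : norm2 x <= spectral_norm S * (2 * (a + 1)) * norm2 x.
  rewrite -{1}(mul1mx x) -(mulVmx Uz) -mulmxA -mulrA.
  apply: le_trans (norm2_mulmx_le _ _) _.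
  by rewrite ler_wpM2l // spectral_norm_ge0.
rewrite -[leLHS]mul1r ler_pM2r //; lra.
Qed.

(** The k-th power of 1 + t <= exp t at t = 1/k. *)
Lemma exprD1V_le_expR1 k : (0 < k)%N -> (1 + k%:R^-1) ^+ k <= expR 1 :> R.
Proof.
move=> k0; have kR : k%:R != 0 :> R by rewrite pnatr_eq0 -lt0n.
rewrite -[leRHS](_ : expR (k%:R^-1) ^+ k = _); last first.
  by rewrite -expRM_natl mulfV.
rewrite lerXn2r ?nnegrE ?expR_ge0 ?addr_ge0 ?invr_ge0 //.
exact: expR_ge1Dx.
Qed.

End Final.

Theorem theorem4p2 (R : realType) (n q : nat) (J A : 'M[R[i]]_n.+1)
    (J_herm : J = J ^t*) (J_unit : J \in unitmx) (J_inv : J = invmx J)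
    (J_inertia : inertia J = ((n.+1 - q)%N, q))
    (A_selfadj : A ^t* *m J = J *m A)
    (A_spectrum : forall z : R[i], eigenvalue A z -> `|z| <= 1) :
  (forall k : nat, (1 <= k)%N ->
     ((spectral_norm (A ^+ k))%:E
        <= ((nu J A)%:R * (1 + k%:R^-1) ^+ k)%:E * kreiss A)%E) /\
  (power_growth A <= (expR 1 * (nu J A)%:R)%:E * kreiss A)%E.
Proof.
have JJ : J *m J = 1%:M by rewrite {2}J_inv mulmxV.
have nu1 : 1 <= (nu J A)%:R :> R by rewrite ler1n nu_gt0.
have nu0 : 0 < (nu J A)%:R :> R by exact: lt_le_trans ltr01 nu1.
have powers k : (1 <= k)%N -> ((spectral_norm (A ^+ k))%:E
    <= ((nu J A)%:R * (1 + k%:R^-1) ^+ k)%:E * kreiss A)%E.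
  move=> k0.
  have c0 : 0 < (nu J A)%:R * (1 + k%:R^-1) ^+ k :> R.
    by rewrite mulr_gt0 // exprn_gt0 // ltr_wpDr // invr_ge0.
  have ub := @kreiss_ub R n A; move: ub (kreiss_ge0 A).
  (* The value -oo contradicts [kreiss_ge0]; at +oo the right side is +oo, its coefficient being
     positive. *)
  case: (kreiss A) => [K| |] // ub K0; last by rewrite gt0_muley ?leey ?lte_fin.
  by rewrite -EFinM lee_fin; apply: (spectral_norm_power_le A_spectrum (esym
    J_herm) JJ A_selfadj) => //.
split => //; apply: ge_ereal_sup => _ [k _ <-].
have c0 : 0 < expR 1 * (nu J A)%:R :> R by rewrite mulr_gt0 ?expR_gt0.
(* The growth also counts A^0, outside the first part: its norm is at most 1, and the right side is
   at least 1 because K >= 1/2, e >= 2 and [nu J A] >= 1. *)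
case: k => [|k]; last first.
  apply: le_trans (powers k.+1 isT) _; rewrite lee_wpmul2r ?kreiss_ge0 //
    lee_fin.
  by rewrite mulrC ler_wpM2r ?exprD1V_le_expR1 // ltW.
have ub := @kreiss_ub R n A; move: ub (kreiss_ge0 A).
case: (kreiss A) => [K| |] // ub K0; last by rewrite gt0_muley ?leey ?lte_fin.
rewrite -EFinM lee_fin expr0; apply: le_trans (spectral_norm1_le R n) _.
have K2 : 2^-1 <= K.
  by apply: half_le_kreiss A_spectrum _ => z z1; rewrite -lee_fin ub.
have e2 : 2 <= expR 1 :> R by exact: expR_ge1Dx.
have en : 2 <= expR 1 * (nu J A)%:R :> R by rewrite -[leLHS]mulr1 ler_pM.
suff : 2 * 2^-1 <= expR 1 * (nu J A)%:R * K by rewrite mulfV.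
by rewrite ler_pM ?invr_ge0.
Qed.
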